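(* The construction is dense for curves of degree $4$; that is, there is a nonempty Zariski-open set $U$ of degree-$4$ plane curves (a nonempty Zariski-open subset $U\subset \mathbb{P}(S_4)\cong\mathbb{P}^{14}$) such that every curve $X\in U$ is constructible.
   Context: Let $S=\mathbb{C}[x,y,z]=\bigoplus_{d\ge 0}S_d$. Degree-$d$ curves in the complex projective plane $\mathbb{P}^2$ are identified with points of the projective space $\mathbb{P}(S_d)$ (nonzero forms of degree $d$ up to nonzero scalar), equipped with the Zariski topology. A curve $X$ of degree $d$ is called constructible if there exist $d+1$ red lines $\ell_1,\dots,\ell_{d+1}$ and $d+1$ blue lines $L_1,\dots,L_{d+1}$ in $\mathbb{P}^2$ such that the $d+1$ points $\ell_i\cap L_i$ ($1\le i\le d+1$) are collinear and the other $d(d+1)$ points $\ell_i\cap L_j$ ($i\ne j$) lie on $X$; here the $(d+1)^2$ points $\ell_i\cap L_j$ are understood to be pairwise distinct. The construction is said to be dense for degree-$d$ curves if there is a nonempty Zariski-open subset $U\subset\mathbb{P}(S_d)$ such that each $X\in U$ is constructible. *)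

(* Defs.v *)
From mathcomp Require Import all_boot all_order all_algebra.
From mathcomp Require Import mpoly.
From mathcomp Require Import complex.
From mathcomp Require Import classical_sets reals.

Set Implicit Arguments.
Unset Strict Implicit.
Unset Printing Implicit Defensive.

Import GRing.Theory.

Local Open Scope ring_scope.
Local Open Scope classical_set_scope.

(* The subspaces of V of (vector space) dimension k. *)
Definition grassmannian (K : fieldType) (V : vectType K) (k : nat) : Type :=
  {W : {vspace V} | \dim W == k}.

(* P(V): a projective point is a one-dimensional subspace of V, that is, a
   nonzero vector up to a nonzero scalar. *)
Definition projective (K : fieldType) (V : vectType K) : Type :=
  grassmannian V 1.

Section Zariski.
Variables (K : fieldType) (V : vectType K).

(* The homogeneous coordinates on P(V) are those of a basis of V fixed by the
   library; another basis gives the same closed sets, as a linear change of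
   variables preserves homogeneity. *)
Definition hcoord (v : V) : 'I_(\dim {:V}) -> K :=
  fun i => coord (vbasis {:V}) i v.

(* The common zeros in P(V) of a set of polynomials. *)
Definition zero_locus (G : set {mpoly K[\dim {:V}]}) : set (projective V) :=
  [set x : projective V | forall g v, G g -> v \in sval x -> g.@[hcoord v] = 0].

Definition zariski_closed (A : set (projective V)) : Prop :=
  exists2 G : set {mpoly K[\dim {:V}]},
    (forall g, G g -> exists e : nat, g \is e.-homog) & A = zero_locus G.

Definition zariski_open (U : set (projective V)) : Prop :=
  zariski_closed (~` U).

End Zariski.

Section PlaneCurves.
Variable R : realType.

Definition point : Type := projective 'rV[R[i]]_3.

(* A line of P^2 is the projectivisation of a plane of C^3. *)
Definition line : Type := grassmannian 'rV[R[i]]_3 2.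

(* P(S_d), where S_d is the space of ternary forms of degree d. *)
Definition curve (d : nat) : Type := projective (dhomog 3 R[i] d).

Definition on_line (p : point) (l : line) : Prop := (sval p <= sval l)%VS.

Definition on_curve (d : nat) (p : point) (X : curve d) : Prop :=
  forall F v, F \in sval X -> v \in sval p -> (F : {mpoly R[i][3]}).@[v 0] = 0.

Definition collinear (I : Type) (p : I -> point) : Prop :=
  exists M : line, forall i, on_line (p i) M.

(* P i j is the point where the red line l i meets the blue line L j; as P i j
   is one-dimensional, the equation with the intersection forces l i and L j
   to be distinct lines. *)
Definition constructible (d : nat) (X : curve d) : Prop :=
  exists (l L : 'I_d.+1 -> line) (P : 'I_d.+1 -> 'I_d.+1 -> point),
    [/\ forall i j, sval (P i j) = (sval (l i) :&: sval (L j))%VS,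
        forall i j i' j', P i j = P i' j' -> i = i' /\ j = j',
        collinear (fun i => P i i)
      & forall i j, i != j -> on_curve (P i j) X].

Definition construction_dense (d : nat) : Prop :=
  exists U : set (curve d),
    [/\ zariski_open U, U !=set0 & forall X, U X -> constructible X].

End PlaneCurves.

(* Main.v *)
Require Import Defs.
From mathcomp Require Import all_boot all_order all_algebra perm all_field.
From mathcomp Require Import mpoly complex classical_sets reals.
From mathcomp Require Import ring zify.

Set Implicit Arguments.
Unset Strict Implicit.
Unset Printing Implicit Defensive.

Import GRing.Theory.

Local Open Scope ring_scope.

(** Write x, y, z for the coordinates of the plane.  Take five red lines l_i
    and five blue lines L_i = l_i + c_i y, so that l_i and L_i meet on the line
    y = 0.  Modulo y both products of five lines agree, hence
      prod L_i - prod l_i = y F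
    for a quartic F, the [residual] of the configuration, and F vanishes at
    each l_i :&: L_j off the line y = 0, that is for i != j.  So F is
    constructible as soon as no three of the ten lines are concurrent
    ([constructible_of_configuration]).  It remains to see that the residuals of
    such configurations contain a nonempty open set of quartics.

    - Being such a residual is a first-order property of the coefficients of F,
      so by quantifier elimination over an algebraically closed field it is
      given by equations and inequations.  Off the zeros of the product of the
      nonzero polynomials that occur in them, the property is constantly true
      or constantly false ([generically_constant]).
    - It is not constantly false.  At the configuration [base_config] the
      derivative of (l, c) |-> F is onto the space of quartics
      ([tangent_onto]), so through its residual there are curves of residuals
      with an arbitrary velocity.  These cannot all lie in a hypersurface: look
      at the lowest-order form of its equation at that point
      ([generic_of_curves]).  The lines of [base_config] are not in general
      position, but the curves are chosen so as to reach at time 1 ten tangent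
      lines of a conic, which are ([position_det_conic]).  So almost all
      configurations along the curve are in general position.
    - A nonzero polynomial h in the coefficients need not be homogeneous, but a
      quartic at which some homogeneous component of h is nonzero has a
      multiple at which h is nonzero, which gives an open set of P(S_4)
      ([generic_in_projective]). *)

(** * Zeros of polynomials in several variables *)

Lemma mpoly_nonroot (K : closedFieldType) n (p : {mpoly K[n]}) :
  p != 0 -> exists y, p.@[y] != 0.
Proof.
move=> nz_p; suff: ~ (forall y, p.@[y] = 0).
  move=> np; have [|h] := boolp.pselect (exists y, p.@[y] != 0) => //.
  by case: np => y; apply/eqP/negPn/negP => ny; apply: h; exists y.
move: nz_p => /eqP nz_p p0; apply: nz_p.
elim: n p p0 => [|n IH] p p0.
  apply/mpolyP => m; have -> : m = 0%MM by apply/mnmP; case.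
  rewrite mcoeff0 -(p0 (fun=> 0)) mevalE [in LHS](mpolyE p) raddf_sum /=.
  apply: eq_bigr => m' _; rewrite mcoeffZ big_ord0 mcoeffX.
  by rewrite (_ : m' = 0%MM) ?eqxx//; apply/mnmP; case.
(* Read p as a polynomial in the last variable; its coefficients vanish
   everywhere, hence are zero by induction. *)
pose w (i : 'I_n) : 'I_n.+1 := widen_ord (leqnSn n) i.
pose r (m : 'X_{1..n.+1}) := [multinom m (w i) | i < n].
have muni0 : muni p = 0.
  apply/polyP => k; rewrite coef0; apply: IH => y.
  pose q := map_poly (meval y) (muni p).
  have q0 : q = 0.
    apply/eqP/negPn/negP => /closed_nonrootP [t] /negP; apply.
    pose yt (i : 'I_n.+1) := oapp y t (insub (i : nat)).
    rewrite /root -(p0 yt) /q muniE mevalE rmorph_sum horner_sum.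
    apply/eqP; apply: eq_bigr => m _.
    rewrite -!mul_polyC !rmorphM /= map_polyXn !map_polyC /= !hornerE.
    rewrite -mul_mpolyC mevalM mevalC mevalX big_ord_recr /= -mulrA.
    congr (_ * (_ * _)); last by rewrite /yt insubF //= ltnn.
    apply: eq_bigr => i _; rewrite mnmE /yt.
    by rewrite insubT //= => lt_i; congr (y _ ^+ _); apply: val_inj.
  by have := congr1 (fun s : {poly K} => s`_k) q0; rewrite coef_map coef0.
apply/mpolyP => m0; rewrite mcoeff0.
have := congr1 (fun s : {poly {mpoly K[n]}} => (s`_(m0 ord_max))@_(r m0)) muni0.
rewrite coef0 mcoeff0 muniE coef_sum raddf_sum /= => <-.
rewrite [in LHS](mpolyE p) raddf_sum /=; apply: eq_bigr => m _.
rewrite mcoeffZ mcoeffX coefZ coefXn -scalerAl mcoeffZ; congr (_ * _).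
have [->|ne] := eqVneq m m0; first by rewrite eqxx mulr1 mcoeffX eqxx.
have [eq_last|_] := eqVneq (m0 ord_max) (m ord_max); last by rewrite mulr0 mcoeff0.
rewrite mulr1 mcoeffX; case: eqP => // eq_r; case/eqP: ne; apply/mnmP => i.
have [lt_i|ge_i] := ltnP i n.
  have -> : i = w (Ordinal lt_i) by apply: val_inj.
  by have /mnmP/(_ (Ordinal lt_i)) := eq_r; rewrite !mnmE.
have -> : i = ord_max; last by [].
by apply: val_inj => /=; apply/eqP; rewrite eqn_leq ge_i -ltnS ltn_ord.
Qed.

(** * First-order properties are generically constant *)

Section FirstOrder.
Variable K : closedFieldType.
Implicit Types (n : nat) (f : GRing.formula K) (t : GRing.term K).

Definition point_env n (y : 'I_n -> K) : seq K := [seq y i | i <- enum 'I_n].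

Lemma size_point_env n (y : 'I_n -> K) : size (point_env y) = n.
Proof. by rewrite size_map size_enum_ord. Qed.

Lemma nth_point_env n (y : 'I_n -> K) (i : 'I_n) : (point_env y)`_i = y i.
Proof. by rewrite (nth_map i) ?size_enum_ord ?nth_ord_enum. Qed.

Lemma rterm_mpoly n t : GRing.rterm t ->
  exists p : {mpoly K[n]}, forall y, GRing.eval (point_env y) t = p.@[y].
Proof.
elim: t => //=.
- move=> k _; have [lt_kn|le_nk] := ltnP k n; last first.
    by exists 0 => y; rewrite meval0 nth_default // size_point_env.
  exists 'X_(Ordinal lt_kn) => y; rewrite mevalXU.
  by rewrite -(nth_point_env y (Ordinal lt_kn)).
- by move=> c _; exists c%:MP => y; rewrite mevalC.
- by move=> k _; exists k%:R => y; rewrite rmorph_nat.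
- move=> t1 IH1 t2 IH2 /andP[/IH1[p1 E1] /IH2[p2 E2]].
  by exists (p1 + p2) => y; rewrite mevalD E1 E2.
- by move=> t1 IH /IH[p E]; exists (- p) => y; rewrite mevalN E.
- by move=> t1 IH k /IH[p E]; exists (p *+ k) => y; rewrite mevalMn E.
- move=> t1 IH1 t2 IH2 /andP[/IH1[p1 E1] /IH2[p2 E2]].
  by exists (p1 * p2) => y; rewrite mevalM E1 E2.
- by move=> t1 IH k /IH[p E]; exists (p ^+ k) => y; rewrite rmorphXn /= E.
Qed.

(** An equation between two distinct polynomials fails off the zeros of their
    difference, one between equal polynomials always holds; connectives
    multiply the exceptional polynomials. *)
Lemma qf_generically_constant n f : GRing.qf_form f -> GRing.rformula f ->
  exists2 h : {mpoly K[n]}, h != 0 &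
    exists b, forall y, h.@[y] != 0 -> GRing.qf_eval (point_env y) f = b.
Proof.
have binop f1 f2 (op : bool -> bool -> bool) :
    (exists2 h : {mpoly K[n]}, h != 0 &
      exists b, forall y, h.@[y] != 0 -> GRing.qf_eval (point_env y) f1 = b) ->
    (exists2 h : {mpoly K[n]}, h != 0 &
      exists b, forall y, h.@[y] != 0 -> GRing.qf_eval (point_env y) f2 = b) ->
    exists2 h : {mpoly K[n]}, h != 0 & exists b, forall y, h.@[y] != 0 ->
      op (GRing.qf_eval (point_env y) f1)
         (GRing.qf_eval (point_env y) f2) = b.
  move=> [h1 nz1 [b1 E1]] [h2 nz2 [b2 E2]].
  exists (h1 * h2); first by rewrite mulf_neq0.
  exists (op b1 b2) => y; rewrite mevalM mulf_eq0 negb_or => /andP[ny1 ny2].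
  by rewrite E1 ?E2.
elim: f => //=.
- by move=> b _ _; exists 1; [exact: oner_neq0 | exists b].
- move=> t1 t2 _ /andP[/(rterm_mpoly n)[p1 E1] /(rterm_mpoly n)[p2 E2]].
  have [eq_p|ne] := eqVneq p1 p2.
    by exists 1; [exact: oner_neq0 | exists true => y _; rewrite E1 E2 eq_p eqxx].
  exists (p1 - p2); first by rewrite subr_eq0.
  by exists false => y; rewrite mevalB subr_eq0 E1 E2 => /negbTE.
- by move=> f1 IH1 f2 IH2 /andP[q1 q2] /andP[r1 r2]; apply: (binop f1 f2 andb); auto.
- by move=> f1 IH1 f2 IH2 /andP[q1 q2] /andP[r1 r2]; apply: (binop f1 f2 orb); auto.
- by move=> f1 IH1 f2 IH2 /andP[q1 q2] /andP[r1 r2]; apply: (binop f1 f2 implb); auto.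
- move=> f1 IH q r; have H := IH q r.
  by apply: (binop f1 f1 (fun b _ => ~~ b)).
Qed.

(** Chevalley's theorem in the form in which it is used: quantifier elimination
    reduces to the quantifier-free case. *)
Lemma generically_constant n f : exists2 h : {mpoly K[n]}, h != 0 &
  exists b : bool, forall y, h.@[y] != 0 ->
    GRing.holds (point_env y) f <-> b.
Proof.
pose g := GRing.quantifier_elim (@ClosedFieldQE.ex_elim K) (GRing.to_rform f).
have wf := @ClosedFieldQE.wf_ex_elim K.
have /andP[qf_g rf_g] : GRing.qf_form g && GRing.rformula g.
  by apply: (GRing.quantifier_elim_wf wf); apply: GRing.to_rform_rformula.
have gP e : reflect (GRing.holds e (GRing.to_rform f)) (GRing.qf_eval e g).
  apply: (GRing.quantifier_elim_rformP wf); last exact: GRing.to_rform_rformula.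
  exact: (ClosedFieldQE.holds_ex_elim (@GRing.solve_monicpoly K)).
have [h nz_h [b hb]] := qf_generically_constant n qf_g rf_g.
exists h => //; exists b => y /hb <-.
exact: iff_trans (iff_sym (GRing.to_rformP _ _)) (rwP (gP _)).
Qed.
End FirstOrder.

Section Blocks.
Variable K : fieldType.
Implicit Types (n m q : nat) (e : seq K) (f : GRing.formula K).

Lemma same_env_cat n m e (x : m.-tuple K) : size e = n ->
  {in [predC iota n m], GRing.same_env e (e ++ x)}.
Proof.
move=> sz_e i; rewrite !inE mem_iota nth_cat sz_e => out.
case: ltnP => [//|le_ni]; rewrite !nth_default ?sz_e ?size_tuple //.
by move: out; rewrite le_ni /= -leqNgt leq_subRL.
Qed.

Lemma same_env_block n m e e' : size e = n ->
    {in [predC iota n m], GRing.same_env e e'} ->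
  GRing.same_env e' (e ++ [tuple e'`_(n + j) | j < m]).
Proof.
move=> sz_e eq_e i; rewrite nth_cat sz_e; case: ltnP => [lt_in|le_ni].
  by rewrite eq_e // !inE mem_iota leqNgt lt_in.
have [lt_im|le_mi] := ltnP (i - n) m.
  by rewrite -(tnth_nth _ _ (Ordinal lt_im)) tnth_mktuple /= subnKC.
rewrite [in RHS]nth_default ?size_tuple // -eq_e ?nth_default ?sz_e //.
by rewrite !inE mem_iota le_ni /= -leqNgt -leq_subRL.
Qed.

Lemma holds_exists_block n m e f : size e = n ->
  GRing.holds e (foldr GRing.Exists f (iota n m)) <->
  exists x : m.-tuple K, GRing.holds (e ++ x) f.
Proof.
move=> sz_e; apply: iff_trans (iff_sym (GRing.foldExistsP _ _ _)) _.
split=> [[e' eq_e f_e']|[x f_x]]; last by exists (e ++ x); [exact: same_env_cat|].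
exists [tuple e'`_(n + j) | j < m].
exact: GRing.eq_holds (same_env_block sz_e eq_e) f_e'.
Qed.

Lemma holds_forall_block n m e f : size e = n ->
  GRing.holds e (foldr GRing.Forall f (iota n m)) <->
  forall x : m.-tuple K, GRing.holds (e ++ x) f.
Proof.
move=> sz_e; apply: iff_trans (iff_sym (GRing.foldForallP _ _ _)) _.
split=> [f_e' x|f_x e' eq_e]; first by apply: f_e'; apply: same_env_cat.
have eq_e' := GRing.same_env_sym (same_env_block sz_e eq_e).
exact: GRing.eq_holds eq_e' (f_x _).
Qed.

(** Terms have no ring structure, so a term is only ever described by the
    function that it computes. *)
Definition polynomial_function (F : seq K -> K) :=
  exists t : GRing.term K, forall e, GRing.eval e t = F e.

Lemma polyfun_const c : polynomial_function (fun=> c).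
Proof. by exists (GRing.Const c). Qed.

Lemma polyfun_nth i : polynomial_function (fun e => e`_i).
Proof. by exists (GRing.Var _ i). Qed.

Lemma polyfun_add F G : polynomial_function F -> polynomial_function G ->
  polynomial_function (fun e => F e + G e).
Proof. by move=> [t tF] [u uG]; exists (GRing.Add t u) => e /=; rewrite tF uG. Qed.

Lemma polyfun_mul F G : polynomial_function F -> polynomial_function G ->
  polynomial_function (fun e => F e * G e).
Proof. by move=> [t tF] [u uG]; exists (GRing.Mul t u) => e /=; rewrite tF uG. Qed.

Lemma polyfun_opp F : polynomial_function F ->
  polynomial_function (fun e => - F e).
Proof. by move=> [t tF]; exists (GRing.Opp t) => e /=; rewrite tF. Qed.

Lemma polyfun_exp F k : polynomial_function F ->
  polynomial_function (fun e => F e ^+ k).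
Proof. by move=> [t tF]; exists (GRing.Exp t k) => e /=; rewrite tF. Qed.

Lemma polyfun_sum (I : Type) (r : seq I) (P : pred I) (F : I -> seq K -> K) :
    (forall i, polynomial_function (F i)) ->
  polynomial_function (fun e => \sum_(i <- r | P i) F i e).
Proof.
move=> pF; elim: r => [|i r [t tF]].
  by exists (GRing.Const 0) => e; rewrite big_nil.
have [u uF] := pF i.
exists (if P i then GRing.Add u t else t) => e; rewrite big_cons.
by case: (P i) => /=; rewrite ?tF ?uF.
Qed.

Lemma polyfun_prod (I : Type) (r : seq I) (P : pred I) (F : I -> seq K -> K) :
    (forall i, polynomial_function (F i)) ->
  polynomial_function (fun e => \prod_(i <- r | P i) F i e).
Proof.
move=> pF; elim: r => [|i r [t tF]].
  by exists (GRing.Const 1) => e; rewrite big_nil.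
have [u uF] := pF i.
exists (if P i then GRing.Mul u t else t) => e; rewrite big_cons.
by case: (P i) => /=; rewrite ?tF ?uF.
Qed.

Lemma polyfun_meval n (p : {mpoly K[n]}) (F : 'I_n -> seq K -> K) :
    (forall i, polynomial_function (F i)) ->
  polynomial_function (fun e => p.@[fun i => F i e]).
Proof.
move=> pF; pose monomial (m : 'X_{1..n}) e := p@_m * \prod_i F i e ^+ m i.
have := polyfun_sum (msupp p) predT (F := monomial).
case=> [m|t tF]; last by exists t => e; rewrite tF mevalE.
apply: polyfun_mul; first exact: polyfun_const.
by apply: polyfun_prod => i; apply: polyfun_exp.
Qed.
End Blocks.

(** The universal quantifier over v makes an identity between forms in v a
    single equation E = 0. *)
Lemma image_generically_constant (K : closedFieldType) n m q
    (G E : seq K -> K) :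
    polynomial_function G -> polynomial_function E ->
  exists2 h : {mpoly K[n]}, h != 0 & exists b : bool, forall y, h.@[y] != 0 ->
    (exists2 x : m.-tuple K, G (point_env y ++ x) != 0 &
      forall v : q.-tuple K, E ((point_env y ++ x) ++ v) = 0) <-> b.
Proof.
move=> [tG eG] [tE eE].
pose inner := foldr GRing.Forall (GRing.Equal tE (GRing.Const 0)) (iota (n + m) q).
pose f := GRing.And (GRing.Not (GRing.Equal tG (GRing.Const 0))) inner.
have [h nz_h [b hb]] := generically_constant n (foldr GRing.Exists f (iota n m)).
exists h => //; exists b => y /hb <-.
apply: iff_trans (iff_sym (holds_exists_block _ _ (size_point_env y))).
have sz (x : m.-tuple K) : size (point_env y ++ x) = (n + m)%N.
  by rewrite size_cat size_point_env size_tuple.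
split=> [[x nzG zE]|[x [/= nzG /(holds_forall_block _ _ (sz x)) zE]]]; exists x.
- split; first by rewrite /= eG; apply/eqP.
  by apply/(holds_forall_block _ _ (sz x)) => v /=; rewrite eE.
- by apply/eqP; rewrite -eG.
- by move=> v; rewrite -eE; apply: zE.
Qed.

(** * A property that holds along curves in all directions holds generically *)

Section Curves.
Variable K : closedFieldType.

Lemma horner_mmap_polyC n (p : {mpoly K[n]}) (y : 'I_n -> {poly K}) t :
  (mmap polyC y p).[t] = p.@[fun k => (y k).[t]].
Proof.
rewrite /meval /mmap horner_sum; apply: eq_bigr => m _ /=.
rewrite hornerM hornerC /mmap1 horner_prod; congr (_ * _).
by apply: eq_bigr => i _; rewrite horner_exp.
Qed.

(** If h is a nonzero polynomial and c, of degree m, is the first nonzero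
    coefficient of h (y0 + s X) as a power series in s, then along a curve
    y0 + t w + O(t^2) the value of h is t^m (c (w) + O(t)).  A velocity w with
    c (w) != 0 thus gives a curve along which h, and any given r != 0, are
    nonzero at almost all times. *)
Lemma generic_of_curves n (h : {mpoly K[n]}) (Q : ('I_n -> K) -> Prop) (b : bool)
    (y0 : 'I_n -> K) :
    h != 0 -> (forall y, h.@[y] != 0 -> Q y <-> b) ->
    (forall w, exists (y : 'I_n -> {poly K}) (r : {poly K}),
      [/\ r != 0, forall k, (y k)`_0 = y0 k /\ (y k)`_1 = w k &
          forall t, r.[t] != 0 -> Q (fun k => (y k).[t])]) ->
  forall y, h.@[y] != 0 -> Q y.
Proof.
move=> nz_h hb curves; suff b_true : b by move=> y /hb ->.
(* hs is h (y0 + s X), as a polynomial in s. *)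
pose hs : {poly {mpoly K[n]}} := mmap (polyC \o @mpolyC n K)
  (fun k => (y0 k)%:MP%:P + 'X * ('X_k)%:P) h.
have hsE z s : (map_poly (meval z) hs).[s] = h.@[fun k => y0 k + s * z k].
  rewrite /meval /hs /mmap -/(meval z) rmorph_sum horner_sum; apply: eq_bigr => m _.
  rewrite rmorphM hornerM /= map_polyC hornerC /= mevalC; congr (_ * _).
  rewrite /mmap1 rmorph_prod horner_prod; apply: eq_bigr => k _.
  rewrite rmorphXn /= horner_exp rmorphD rmorphM /= map_polyX !map_polyC /=.
  by rewrite mevalC mevalXU !hornerE.
have nz_hs : exists j, hs`_j != 0.
  have [y ny] := mpoly_nonroot nz_h.
  exists (size hs).-1; rewrite -/(lead_coef hs) lead_coef_eq0.
  apply/eqP => hs0; case/eqP: ny.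
  have := hsE (fun k => y k - y0 k) 1; rewrite hs0 rmorph0 horner0 => ->.
  by apply: meval_eq => k; rewrite mul1r addrC subrK.
case: (ex_minnP nz_hs) => m nz_m min_m.
have hs_dropE : hs = drop_poly m hs * 'X^m.
  rewrite -[LHS](poly_take_drop m) (_ : take_poly m hs = 0) ?add0r //.
  apply/polyP => j; rewrite coef_take_poly coef0; case: ltnP => // lt_jm.
  by apply/eqP/negPn/negP => /min_m; rewrite leqNgt lt_jm.
set hd := drop_poly m hs in hs_dropE.
have hd0 : hd`_0 = hs`_m by rewrite coef_drop_poly.
have [w nz_w] := mpoly_nonroot nz_m.
have [y [r [nz_r yE Qy]]] := curves w.
pose z k := drop_poly 1 (y k).
have yzE k t : (y k).[t] = y0 k + t * (z k).[t].
  rewrite -{1}(poly_take_drop 1 (y k)) hornerD hornerMX -/(z k) mulrC.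
  congr (_ + _); rewrite (_ : take_poly 1 (y k) = (y0 k)%:P) ?hornerC //.
  apply/polyP => j; rewrite coef_take_poly coefC ltnS leqn0.
  by case: eqP => // ->; have [] := yE k.
(* z k is (y k - y0 k) / t, and h along the curve is t^m P. *)
pose P := \sum_(j < size hd) mmap polyC z hd`_j * 'X^j.
have PE t : P.[t] = (map_poly (meval (fun k => (z k).[t])) hd).[t].
  rewrite (horner_coef_wide _ (size_poly _ _)) /P horner_sum.
  by apply: eq_bigr => j _; rewrite coef_map hornerM horner_mmap_polyC hornerXn.
have nz_P : P != 0.
  apply: contraNneq nz_w => P0; have := PE 0; rewrite P0 horner0 horner_coef0.
  rewrite coef_map /= hd0 => ->; apply/eqP; apply: meval_eq => k.
  by rewrite horner_coef0 coef_drop_poly; have [] := yE k.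
have /closed_nonrootP[t] : 'X * P * r != 0 by rewrite !mulf_neq0 // polyX_eq0.
rewrite /root !hornerE !mulf_eq0 !negb_or => /andP[/andP[nz_t nz_Pt] /Qy].
suff ny : h.@[fun k => (y k).[t]] != 0 by move/(hb _ ny).
rewrite (_ : h.@[_] = t ^+ m * P.[t]) ?mulf_neq0 ?expf_neq0 //.
rewrite (meval_eq _ (fun k => yzE k t)) -hsE {1}hs_dropE rmorphM /= map_polyXn.
by rewrite hornerM hornerXn mulrC PE.
Qed.
End Curves.

(** * From affine to projective open sets *)

Lemma projective_pointE (K : fieldType) (V : vectType K) (X : projective V) v :
  v \in sval X -> v != 0 -> sval X = <[v]>%VS.
Proof.
case: X => W /= /eqP dimW Wv nz_v.
by apply/esym/eqP; rewrite eqEdim -memvE Wv dimW dim_vline nz_v.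
Qed.

Section ProjectiveOpen.
Local Open Scope classical_set_scope.

Lemma meval_dhomog (R : comNzRingType) n d (p : {mpoly R[n]}) s (y : 'I_n -> R) :
  p \is d.-homog -> p.@[fun k => s * y k] = s ^+ d * p.@[y].
Proof.
move=> /dhomogP hom_p; rewrite !mevalE mulr_sumr !big_seq.
apply: eq_bigr => m /hom_p <-; rewrite mulrCA; congr (_ * _).
rewrite -[RHS]/(s ^+ mdeg m * _) mdegE -prodrXr -big_split; apply: eq_bigr => i _.
by rewrite exprMn.
Qed.

Variables (K : closedFieldType) (V : vectType K).

(** The open set is the complement of the common zeros of the homogeneous
    components of h. *)
Lemma generic_in_projective (h : {mpoly K[\dim {:V}]}) :
    h != 0 -> (0 < \dim {:V})%N ->
  exists U : set (projective V), [/\ zariski_open U, U !=set0 &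
    forall X, U X -> exists2 v, v \in sval X & v != 0 /\ h.@[hcoord v] != 0].
Proof.
move=> nz_h V_gt0.
pose G := [set g | exists e, g = pihomog mdeg e h].
have notZ (X : projective V) : ~ zero_locus G X <->
    exists e v, v \in sval X /\ (pihomog mdeg e h).@[hcoord v] != 0.
  split=> [nZ|[e [v [Xv nz]]] Z]; last first.
    by case/eqP: nz; apply: Z => //; exists e.
  apply: boolp.contrapT => nex; apply: nZ => g v [e ->] Xv.
  by apply/eqP/negPn/negP => nz; apply: nex; exists e, v.
exists (~` zero_locus G); split.
- rewrite /zariski_open setCK; exists G => // g [e ->].
  by exists e; apply: pihomogP.
- have nz_hX : h * 'X_(Ordinal V_gt0) != 0 by rewrite mulf_neq0 // -msupp_eq0 msuppX.
  have [y] := mpoly_nonroot nz_hX.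
  rewrite mevalM mevalXU mulf_eq0 negb_or => /andP[ny nz_y0].
  pose v := \sum_(i < \dim {:V}) y i *: (vbasis {:V})`_i.
  have vE : hcoord v =1 y.
    by move=> i; rewrite /hcoord coord_sum_free // (basis_free (vbasisP _)).
  have nz_v : v != 0.
    apply: contraNneq nz_y0 => v0.
    by rewrite -vE v0 /hcoord linear0.
  have dim_v : \dim <[v]> == 1%N by rewrite dim_vline nz_v.
  exists (exist _ <[v]>%VS dim_v : projective V); apply/notZ => /=.
  apply: boolp.contrapT => nex; case/eqP: ny.
  rewrite (pihomog_partitionE (leqnn (mmeasure mdeg h))) raddf_sum /= big1 // => e _.
  rewrite -(meval_eq _ vE); apply/eqP/negPn/negP => nz.
  by apply: nex; exists e, v; rewrite memv_line.
move=> X /notZ [e [v [Xv nz]]].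
pose v' := vpick (sval X).
have nz_v' : v' != 0 by rewrite vpick0 -dimv_eq0 (eqP (svalP X)).
have XE : sval X = <[v']>%VS := projective_pointE (memv_pick _) nz_v'.
have hcoordZ s : hcoord (s *: v') =1 fun i => s * hcoord v' i.
  by move=> i; rewrite /hcoord linearZ.
move: Xv; rewrite XE => /vlineP [s vE].
have nz_e : (pihomog mdeg e h).@[hcoord v'] != 0.
  apply: contraNneq nz => e0; rewrite vE (meval_eq _ (hcoordZ s)).
  by rewrite (meval_dhomog _ _ (pihomogP _ _ _)) e0 mulr0.
pose k := mmeasure mdeg h.
(* P.[t] is the value of h at t *: v'. *)
pose P := \poly_(d < k) (pihomog mdeg d h).@[hcoord v'].
have lt_ek : (e < k)%N.
  rewrite ltnNge; apply: contraNN nz_e => le_ke; apply/eqP.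
  rewrite /pihomog big_seq_cond big_pred0 ?meval0 // => m.
  apply/negP => /andP[m_h /eqP eq_e]; have := mmeasure_mnm_lt mdeg m_h.
  by rewrite eq_e ltnNge le_ke.
have nz_P : P != 0.
  apply: contraNneq nz_e => P0; have : P`_e = 0 by rewrite P0 coef0.
  by rewrite coef_poly lt_ek => ->.
have /closed_nonrootP[t] : 'X * P != 0 by rewrite mulf_neq0 ?polyX_eq0.
rewrite /root hornerM hornerX mulf_eq0 negb_or => /andP[nz_t nz_Pt].
exists (t *: v'); first by rewrite memvZ ?memv_line.
split; first by rewrite scaler_eq0 negb_or nz_t.
apply: contraNneq nz_Pt => ht; rewrite -ht (meval_eq _ (hcoordZ t)); apply/eqP.
rewrite [in RHS](pihomog_partitionE (leqnn (mmeasure mdeg h))) raddf_sum /=.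
rewrite horner_poly; apply: eq_bigr => d _.
by rewrite (meval_dhomog _ _ (pihomogP _ _ _)) mulrC.
Qed.
End ProjectiveOpen.

(** * Configurations of red and blue lines, and their residual quartic *)

Section LineConfiguration.
Variable A : comNzRingType.
Implicit Types (a d : 'I_5 -> nat -> A) (v : 'I_3 -> A) (p : 'I_5 * bool).

(** Row i of the array a holds the three coefficients of the red line l_i and,
    in column 3, the number c_i such that the blue line is l_i + c_i y, where y
    is the coordinate of index 1.  The pair (i, b) names the line l_i if b is
    false, and L_i if b is true. *)
Definition line_coef a p (k : 'I_3) : A :=
  a p.1 k + a p.1 3 *+ (p.2 && (k == 1%N :> nat)).

Definition line_form a p v : A := \sum_k line_coef a p k * v k.

(** Nonzero exactly when no three of the ten lines are concurrent. *)
Definition position_det a : A :=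
  \prod_(f : {ffun 'I_3 -> 'I_5 * bool} | injectiveb f)
    \det (\matrix_(j, k) line_coef a (f j) k).

(** The quotient by y of prod L_i - prod l_i, written as a telescoping sum so
    that it is polynomial in a and v. *)
Definition residual a v : A :=
  \sum_i a i 3 * \prod_(j | j != i) line_form a (j, (j < i)%N) v.

Lemma line_form_blue a i v :
  line_form a (i, true) v = line_form a (i, false) v + a i 3 * v 1.
Proof.
rewrite /line_form /line_coef !big_ord_recl !big_ord0 /= /bump /=.
have -> : lift ord0 ord0 = 1 :> 'I_3 by apply: val_inj.
ring.
Qed.

Lemma residualE a v : v 1 * residual a v =
  \prod_i line_form a (i, true) v - \prod_i line_form a (i, false) v.
Proof.
pose P k := \prod_(j < 5) line_form a (j, (j < k)%N) v.
have -> : \prod_i line_form a (i, true) v = P 5.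
  by apply: eq_bigr => i _; rewrite ltn_ord.
have -> : \prod_i line_form a (i, false) v = P 0 by apply: eq_bigr.
rewrite -(telescope_sumr _ (leq0n 5)) big_mkord mulr_sumr.
apply: eq_bigr => i _; rewrite /P.
rewrite [X in _ = X - _](bigD1 i) // [X in _ = _ - X](bigD1 i) //=.
rewrite ltnn ltnSn line_form_blue.
have -> : \prod_(j | j != i) line_form a (j, (j < i.+1)%N) v =
          \prod_(j | j != i) line_form a (j, (j < i)%N) v.
  by apply: eq_bigr => j ne; rewrite ltnS leq_eqVlt val_eqE (negbTE ne).
ring.
Qed.

(** The derivative at a in the direction d of prod L_i - prod l_i, that is, of
    y times the residual. *)
Definition tangent a d v : A :=
  \sum_i line_form d (i, true) v * \prod_(j | j != i) line_form a (j, true) v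
  - \sum_i line_form d (i, false) v * \prod_(j | j != i) line_form a (j, false) v.

End LineConfiguration.

Section LineConfigurationMorphism.
Variables (A B : comNzRingType) (phi : {rmorphism A -> B}).
Variables (a : 'I_5 -> nat -> A) (v : 'I_3 -> A).

Lemma rmorph_line_coef p k :
  phi (line_coef a p k) = line_coef (fun i j => phi (a i j)) p k.
Proof. by rewrite rmorphD rmorphMn. Qed.

Lemma rmorph_line_form p :
  phi (line_form a p v) = line_form (fun i j => phi (a i j)) p (phi \o v).
Proof.
by rewrite rmorph_sum; apply: eq_bigr => k _; rewrite rmorphM rmorph_line_coef.
Qed.

Lemma rmorph_position_det :
  phi (position_det a) = position_det (fun i j => phi (a i j)).
Proof.
rewrite rmorph_prod; apply: eq_bigr => f _; rewrite -det_map_mx; congr (\det _).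
by apply/matrixP => j k; rewrite !mxE rmorph_line_coef.
Qed.

Lemma rmorph_residual :
  phi (residual a v) = residual (fun i j => phi (a i j)) (phi \o v).
Proof.
rewrite rmorph_sum; apply: eq_bigr => i _; rewrite rmorphM rmorph_prod.
by congr (_ * _); apply: eq_bigr => j _; rewrite rmorph_line_form.
Qed.
End LineConfigurationMorphism.

Lemma coef0_prod (A : comNzRingType) (I : finType) (P : pred I) (F : I -> {poly A}) :
  (\prod_(i | P i) F i)`_0 = \prod_(i | P i) (F i)`_0.
Proof.
rewrite -horner_coef0 horner_prod; apply: eq_bigr => i _; exact: horner_coef0.
Qed.

Lemma coef1_prod (A : comNzRingType) (I : finType) (F : I -> {poly A}) :
  (\prod_i F i)`_1 = \sum_i (F i)`_1 * \prod_(j | j != i) (F j)`_0.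
Proof.
suff main (r : seq I) : uniq r ->
    (\prod_(i <- r) F i)`_1 =
    \sum_(i <- r) (F i)`_1 * \prod_(j <- r | j != i) (F j)`_0.
  by rewrite main ?index_enum_uniq.
elim: r => [|x r IH] /=; first by rewrite !big_nil coefC.
move=> /andP[x_r uniq_r]; rewrite !big_cons coefM !big_ord_recr big_ord0 /= add0r.
rewrite eqxx /= subn0 subnn IH // addrC; congr (_ * _ + _).
  rewrite -horner_coef0 horner_prod big_seq_cond [RHS]big_seq_cond.
  apply: eq_big => [i|i _]; last exact: horner_coef0.
  by rewrite andbT andb_idr // => i_r; apply: contraNneq x_r => <-.
rewrite mulr_sumr !big_seq; apply: eq_bigr => i i_r; rewrite big_cons ifT 1?mulrCA //.
by apply: contraNneq x_r => ->.
Qed.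

(** * The derivative of the residual is onto at one configuration *)

(** Here L_i is x, z, x + z, x - z, z - 2 x, and l_i is L_i + y. *)
Definition base_config : seq (seq int) :=
  [:: [:: 1; 1; 0; -1]; [:: 0; 1; 1; -1]; [:: 1; 1; 1; -1]; [:: 1; 1; -1; -1];
      [:: -2; 1; 1; -1]].

Definition int_config (A : comNzRingType) (s : seq (seq int)) : 'I_5 -> nat -> A :=
  fun i k => (nth 0 (nth [::] s i) k)%:~R.

(** A direction in which the derivative of the residual at [base_config] is
    6 x^a y^(4-a-c) z^c, in rows as in [line_coef].  Solutions exist for the
    following reason.  As no two of the binary forms L_i in x and z are
    proportional, moving the c_i alone yields the span of the products of four L_j, which
    is that of the quartics in x and z.  Modulo these, moving l_i and L_i
    together by a binary linear form m_i contributes y times a combination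
    that is unitriangular in sum m_i, sum m_i L_i and sum m_i L_i^2, with
    coefficients y^2, y and 1.  The five L_i are general enough for these three
    sums to take all values, and y^4 is obtained by moving one l_i by a
    multiple of y. *)
Definition monomial_direction (a c : nat) : seq (seq int) :=
  match a, c with
  | 0, 0 => [:: [:: 6; 0; -24; -30]; [:: -12; 0; 18; -15]; [:: 10; -10; 0; 61];
              [:: 0; 6; 0; -9]; [:: 2; -2; 0; -25]]
  | 0, 1 => [:: [:: 0; -12; 18; 36]; [:: 0; 18; 0; -18]; [:: -15; 0; 0; -22];
              [:: -3; -6; 0; 6]; [:: 0; 0; 0; 34]]
  | 0, 2 => [:: [:: 0; -6; -12; -12]; [:: 0; 0; 0; 0]; [:: 0; 3; 12; 10];
              [:: 0; 3; 0; -6]; [:: 0; 0; 0; -16]]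
  | 0, 3 => [:: [:: 0; 0; 6; 12]; [:: 0; 0; 0; 0]; [:: 0; 0; -3; -4];
              [:: 0; 0; -3; 0]; [:: 0; 0; 0; 16]]
  | 0, 4 => [:: [:: 0; 0; 0; -6]; [:: 0; 0; 0; 0]; [:: 0; 0; 0; 1];
              [:: 0; 0; 0; -3]; [:: 0; 0; 0; -16]]
  | 1, 0 => [:: [:: 6; 0; 0; 0]; [:: 9; 3; 0; 9]; [:: -15; 0; 0; -8];
              [:: -3; 0; 0; 0]; [:: 3; -3; 0; 11]]
  | 1, 1 => [:: [:: 0; 0; 0; 0]; [:: 0; 0; -6; 0]; [:: 0; 0; 6; -7];
              [:: 0; 0; 0; -3]; [:: 0; 0; 0; -2]]
  | 1, 2 => [:: [:: 6; 0; 0; 0]; [:: 0; 0; 0; 0]; [:: -3; 0; 0; 4];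
              [:: -3; 0; 0; 0]; [:: 0; 0; 0; 8]]
  | 1, 3 => [:: [:: 0; 0; 0; 0]; [:: 0; 0; 0; 0]; [:: 0; 0; 0; -1];
              [:: 0; 0; 0; -3]; [:: 0; 0; 0; -8]]
  | 2, 0 => [:: [:: 0; 0; 0; 0]; [:: -6; 0; 0; -9]; [:: 6; 0; 0; 7];
              [:: 0; 0; 0; -3]; [:: 0; 0; 0; -1]]
  | 2, 1 => [:: [:: 0; 0; 0; 0]; [:: 0; 0; 3; 0]; [:: 0; 0; -2; 3];
              [:: 0; 0; 0; 3]; [:: 0; 0; -1; 0]]
  | 2, 2 => [:: [:: 0; 0; 0; 0]; [:: 0; 0; 0; 0]; [:: 0; 0; 0; 1];
              [:: 0; 0; 0; -3]; [:: 0; 0; 0; -4]]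
  | 3, 0 => [:: [:: 0; 0; 0; 0]; [:: 3; 0; 0; 6]; [:: -2; 0; 0; -3];
              [:: 0; 0; 0; 3]; [:: -1; 0; 0; 0]]
  | 3, 1 => [:: [:: 0; 0; 0; 0]; [:: 0; 0; 0; 0]; [:: 0; 0; 0; -1];
              [:: 0; 0; 0; -3]; [:: 0; 0; 0; -2]]
  | 4, 0 => [:: [:: 0; 0; 0; 0]; [:: 0; 0; 0; -3]; [:: 0; 0; 0; 1];
              [:: 0; 0; 0; -3]; [:: 0; 0; 0; -1]]
  | _, _ => [::]
  end.

Lemma big_skip5 (A : comNzRingType) (f g : 'I_5 -> A) :
  \sum_i f i * \prod_(j | j != i) g j =
  let F k := f (inord k) in let G k := g (inord k) in
  F 0 * G 1 * G 2 * G 3 * G 4 + G 0 * F 1 * G 2 * G 3 * G 4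
  + G 0 * G 1 * F 2 * G 3 * G 4 + G 0 * G 1 * G 2 * F 3 * G 4
  + G 0 * G 1 * G 2 * G 3 * F 4.
Proof.
under eq_bigr do rewrite big_mkcond.
rewrite !big_ord_recl !big_ord0 /=.
have ordE (i : 'I_5) k : i = k :> nat -> i = inord k.
  by move=> <-; rewrite inord_val.
have e0 : ord0 = inord 0 :> 'I_5 by apply: ordE.
have e1 : lift ord0 ord0 = inord 1 :> 'I_5 by apply: ordE.
have e2 : lift ord0 (lift ord0 ord0) = inord 2 :> 'I_5 by apply: ordE.
have e3 : lift ord0 (lift ord0 (lift ord0 ord0)) = inord 3 :> 'I_5 by apply: ordE.
have e4 : lift ord0 (lift ord0 (lift ord0 (lift ord0 ord0))) = inord 4 :> 'I_5.
  by apply: ordE.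
rewrite e4 e3 e2 e1 e0.
ring.
Qed.

Lemma line_form_int_config (A : comNzRingType) s (i : nat) b (v : 'I_3 -> A) :
  (i < 5)%N ->
  line_form (int_config A s) (inord i, b) v =
  let n k := nth 0 (nth [::] s i) k in
  (n 0%N)%:~R * v 0 + (n 1%N + n 3%N *+ b)%:~R * v 1 + (n 2%N)%:~R * v 2%:R.
Proof.
move=> lt_i5; rewrite /line_form /line_coef /int_config !big_ord_recl !big_ord0 /=.
rewrite inordK // /bump /= andbF andbT mulr0n.
have -> : lift ord0 ord0 = 1 :> 'I_3 by apply: val_inj.
have -> : lift ord0 (lift ord0 ord0) = 2%:R :> 'I_3 by apply: val_inj.
by rewrite !addr0 addrA rmorphD rmorphMn.
Qed.

Lemma tangent_monomial (A : comNzRingType) (v : 'I_3 -> A) a b c :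
  (a + b + c = 4)%N ->
  6%:R * (v 1 * (v 0 ^+ a * v 1 ^+ b * v 2%:R ^+ c)) =
  tangent (int_config A base_config) (int_config A (monomial_direction a c)) v.
Proof.
move=> sum4; have -> : b = (4 - a - c)%N by lia.
have : (a + c <= 4)%N by lia.
clear b sum4.
do 5?[case: a => [|a]; first do 5?[case: c => [|c]]] => //.
all: rewrite /tangent !big_skip5 /= !line_form_int_config //=.
all: move=> _; ring.
Qed.

Lemma tangent_linear (A : comNzRingType) (a d d' : 'I_5 -> nat -> A) c v :
  tangent a (fun i k => c * d i k + d' i k) v =
  c * tangent a d v + tangent a d' v.
Proof.
have line_linear p : line_form (fun i k => c * d i k + d' i k) p v =
    c * line_form d p v + line_form d' p v.
  rewrite /line_form /line_coef mulr_sumr -big_split; apply: eq_bigr => k _ /=.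
  case: (p.2 && _); rewrite ?mulr0n ?mulr1n; ring.
rewrite /tangent mulrBr !mulr_sumr addrACA -opprD -!big_split /=.
by congr (_ - _); apply: eq_bigr => i _; rewrite line_linear; ring.
Qed.

Section QuarticTangent.
Variable K : numFieldType.
Local Notation X := (fun k : 'I_3 => 'X_k : {mpoly K[3]}).

Definition mconst_config (d : 'I_5 -> nat -> K) (i : 'I_5) (k : nat) : {mpoly K[3]} :=
  (d i k)%:MP.

Lemma tangent_onto (W : {mpoly K[3]}) : W \is 4.-homog ->
  exists d : 'I_5 -> nat -> K, 'X_1 * W =
    tangent (mconst_config (int_config K base_config)) (mconst_config d) X.
Proof.
move=> /dhomogP hom_W.
suff sum_onto (s : seq 'X_{1..3}) : {in s, forall m, mdeg m = 4%N} ->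
    exists d : 'I_5 -> nat -> K, 'X_1 * (\sum_(m <- s) W@_m *: 'X_[m]) =
      tangent (mconst_config (int_config K base_config)) (mconst_config d) X.
  by rewrite {1}(mpolyE W); apply: sum_onto.
elim: s => [|m s IH] hom_s.
  exists (fun _ _ => 0); rewrite big_nil mulr0 /tangent.
  have line0 p : line_form (mconst_config (fun _ _ => 0)) p X = 0.
    rewrite /line_form big1 // => k _.
    by rewrite /line_coef /mconst_config mpolyC0 mul0rn addr0 mul0r.
  by rewrite !big1 ?subr0 // => i _; rewrite line0 mul0r.
have [|d dE] := IH; first by move=> m' m'_s; apply: hom_s; rewrite inE m'_s orbT.
have deg_m : (m 0%R + m 1%R + m 2%:R%R = 4)%N.
  rewrite -[RHS](hom_s m) ?mem_head // mdegE !big_ord_recl big_ord0 addn0 addnA.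
  by congr (m _ + m _ + m _)%N; apply: val_inj.
pose d6 := int_config K (monomial_direction (m 0) (m 2%:R)).
have Xm : 'X_[m] = 'X_0 ^+ m 0 * 'X_1 ^+ m 1 * 'X_(2%:R) ^+ m 2%:R :> {mpoly K[3]}.
  rewrite mpolyXE_id !big_ord_recl big_ord0 mulr1 mulrA.
  by congr ('X__ ^+ m _ * 'X__ ^+ m _ * 'X__ ^+ m _); apply: val_inj.
have int_mconst t i k :
    int_config {mpoly K[3]} t i k = mconst_config (int_config K t) i k.
  by rewrite /int_config /mconst_config -[RHS]/(mpolyC 3 _) rmorph_int.
have int_base : mconst_config (int_config K base_config) =
    int_config {mpoly K[3]} base_config.
  by apply/boolp.funext => i; apply/boolp.funext => k; rewrite int_mconst.
have six : (W@_m / 6%:R)%:MP * 6%:R = (W@_m)%:MP :> {mpoly K[3]}.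
  by rewrite -(rmorph_nat (@mpolyC 3 K)) -mpolyCM divfK // Num.Theory.pnatr_eq0.
exists (fun i k => W@_m / 6%:R * d6 i k + d i k).
have -> : mconst_config (fun i k => W@_m / 6%:R * d6 i k + d i k) =
    (fun i k => (W@_m / 6%:R)%:MP * mconst_config d6 i k + mconst_config d i k).
  apply/boolp.funext => i; apply/boolp.funext => k.
  by rewrite /mconst_config mpolyCD mpolyCM.
rewrite tangent_linear -dE big_cons mulrDr; congr (_ + _).
have -> : mconst_config d6 =
    int_config {mpoly K[3]} (monomial_direction (m 0) (m 2%:R)).
  by apply/boolp.funext => i; apply/boolp.funext => k; rewrite int_mconst.
by rewrite int_base -(tangent_monomial _ deg_m) mulrA six -mul_mpolyC Xm mulrCA.
Qed.
End QuarticTangent.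

(** * Configurations in general position realise the construction *)

Section Geometry.
Variable K : fieldType.
Implicit Types (a : 'I_5 -> nat -> K) (p q r : 'I_5 * bool).

Lemma position_det_triple a p q r : position_det a != 0 ->
    p != q -> p != r -> q != r ->
  exists2 f : {ffun 'I_3 -> 'I_5 * bool},
    [/\ f 0 = p, f 1 = q & f 2%:R = r] &
    \det (\matrix_(j, k) line_coef a (f j) k) != 0.
Proof.
move=> /prodf_neq0 nz pq pr qr.
pose f := [ffun j : 'I_3 => nth p [:: p; q; r] j].
have inj_f : injectiveb f.
  apply/injectiveP => j k; rewrite !ffunE => /eqP.
  rewrite nth_uniq //= ?inE ?negb_or ?pq ?pr ?qr // => /eqP eq_jk.
  exact: val_inj.
by exists f; [rewrite !ffunE | exact: nz].
Qed.

Lemma no_common_zero a p q r (u : 'rV[K]_3) : position_det a != 0 ->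
    p != q -> p != r -> q != r ->
    line_form a p (u 0) = 0 -> line_form a q (u 0) = 0 -> line_form a r (u 0) = 0 ->
  u = 0.
Proof.
move=> nz pq pr qr up uq ur.
have [f [f0 f1 f2] nz_det] := position_det_triple nz pq pr qr.
set M := \matrix_(j, k) _ in nz_det.
have unitM : M^T \in unitmx by rewrite unitmx_tr unitmxE unitfE.
suff uM : u *m M^T = 0 by rewrite -[u](mulmxK unitM) uM mul0mx.
apply/matrixP => i j; rewrite ord1 !mxE.
transitivity (line_form a (f j) (u 0)).
  by apply: eq_bigr => k _; rewrite !mxE mulrC.
have : j \in [:: 0; 1; 2%:R] by rewrite !inE; case: j => -[|[|[]]].
by rewrite !inE => /or3P[] /eqP ->; rewrite ?f0 ?f1 ?f2.
Qed.

Definition coef_kernel (c : 'I_3 -> K) : {vspace 'rV[K]_3} :=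
  lker (linfun (mulmxr (\col_k c k))).

Lemma mem_coef_kernel c (u : 'rV[K]_3) :
  (u \in coef_kernel c) = (\sum_k c k * u 0 k == 0).
Proof.
rewrite memv_ker lfunE /=; apply/eqP/eqP => [/matrixP/(_ 0 0)|uc].
  by rewrite !mxE => uc; rewrite -[RHS]uc; apply: eq_bigr => k _; rewrite mxE mulrC.
apply/matrixP => i j; rewrite !ord1 !mxE -[RHS]uc.
by apply: eq_bigr => k _; rewrite mxE mulrC.
Qed.

Lemma dim_coef_kernel c k : c k != 0 -> \dim (coef_kernel c) == 2%N.
Proof.
move=> nz_c; pose f := linfun (mulmxr (\col_j c j)) : 'Hom('rV[K]_3, 'rV[K]_1).
have := limg_ker_dim f fullv; rewrite capfv dimvf /dim /= => dimE.
rewrite -[coef_kernel c]/(lker f).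
suff img1 : \dim (f @: fullv) = 1%N.
  by move: dimE; rewrite img1 addn1 => -[->].
apply/eqP; rewrite eqn_leq; apply/andP; split.
  by apply: leq_trans (dimvS (subvf _)) _; rewrite dimvf.
rewrite lt0n dimv_eq0; apply/eqP => img0.
have : f (delta_mx 0 k) \in (f @: fullv)%VS by rewrite memv_img ?memvf.
rewrite img0 memv0 lfunE /= => /eqP/matrixP/(_ 0 0).
by rewrite -rowE !mxE => ck; rewrite ck eqxx in nz_c.
Qed.

Variables (a : 'I_5 -> nat -> K) (a_gen : position_det a != 0).

Definition line_space p := coef_kernel (line_coef a p).

Lemma mem_line p (u : 'rV[K]_3) : (u \in line_space p) = (line_form a p (u 0) == 0).
Proof. exact: mem_coef_kernel. Qed.

Lemma two_other_lines p : exists q r, [/\ p != q, p != r & q != r].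
Proof.
case: p => i b; have [j ne_ij] : exists j : 'I_5, i != j.
  by have [->|nz_i] := eqVneq i 0; [exists 1 | exists 0].
exists (i, ~~ b), (j, b).
by rewrite !xpair_eqE (negbTE ne_ij) /= eqxx; case: b.
Qed.

Lemma dim_line p : \dim (line_space p) == 2%N.
Proof.
have [q [r [pq pr qr]]] := two_other_lines p.
have [f [f0 _ _]] := position_det_triple a_gen pq pr qr.
rewrite (expand_det_row _ 0) => nz_det.
have [k nz_k] : exists k, line_coef a p k != 0.
  apply: boolp.contrapT => all0; case/eqP: nz_det; apply: big1 => k _.
  rewrite mxE f0; have [->|nz] := eqVneq (line_coef a p k) 0; first by rewrite mul0r.
  by case: all0; exists k.
exact: dim_coef_kernel nz_k.
Qed.

Lemma another_line p q : exists r, p != r /\ q != r.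
Proof.
have [r [s [pr ps rs]]] := two_other_lines p.
by have [qr|] := eqVneq q r; [exists s; rewrite ps qr rs | exists r].
Qed.

(** At most 1, as a third line meets the intersection only in 0; at least 1, as
    two planes of a space of dimension 3 do not meet only in 0. *)
Lemma dim_meet p q : p != q -> \dim (line_space p :&: line_space q)%VS == 1%N.
Proof.
move=> pq; have [r [pr qr]] := another_line p q.
have dim3 (U : {vspace 'rV[K]_3}) : (\dim U <= 3)%N.
  by apply: leq_trans (dimvS (subvf _)) _; rewrite dimvf.
rewrite eqn_leq; apply/andP; split.
  set W := (_ :&: _)%VS.
  have WR0 : (W :&: line_space r)%VS = 0%VS.
    apply/eqP; rewrite -subv0; apply/subvP => u.
    rewrite !memv_cap !mem_line => /andP[/andP[/eqP up /eqP uq] /eqP ur].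
    by rewrite (no_common_zero a_gen pq pr qr up uq ur) mem0v.
  have := dimv_sum_cap W (line_space r); rewrite WR0 dimv0 addn0 (eqP (dim_line r)).
  by move=> dimE; have := dim3 (W + line_space r)%VS; rewrite dimE addn2.
have := dimv_sum_cap (line_space p) (line_space q).
rewrite (eqP (dim_line p)) (eqP (dim_line q)) => dimE.
have := dim3 (line_space p + line_space q)%VS.
by move: dimE; case: (\dim (_ :&: _)) => //; rewrite addn0 => ->.
Qed.

Lemma red_ne_blue (i j : 'I_5) : (i, false) != (j, true).
Proof. by rewrite xpair_eqE andbF. Qed.

Definition meet i j := (line_space (i, false) :&: line_space (j, true))%VS.

Lemma mem_meet i j (u : 'rV[K]_3) : u \in meet i j ->
  line_form a (i, false) (u 0) = 0 /\ line_form a (j, true) (u 0) = 0.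
Proof. by rewrite memv_cap !mem_line => /andP[/eqP-> /eqP->]. Qed.

(** At a common point of l_i, L_j, l_i' and L_j', three of the ten lines are
    concurrent if i != i' or j != j'. *)
Lemma meet_inj i j i' j' : meet i j = meet i' j' -> i = i' /\ j = j'.
Proof.
move=> eq_meet; pose u := vpick (meet i j).
have nz_u : u != 0 by rewrite vpick0 -dimv_eq0 (eqP (dim_meet (red_ne_blue i j))).
have Pu : u \in meet i j := memv_pick _.
have [ui uj] := mem_meet Pu.
have [ui' uj'] : line_form a (i', false) (u 0) = 0 /\ line_form a (j', true) (u 0) = 0.
  by apply: mem_meet; rewrite -eq_meet.
split; apply/eqP/negPn/negP => ne; case/eqP: nz_u.
  have ne2 : (i, false) != (i', false) by rewrite xpair_eqE andbT.
  exact: (no_common_zero a_gen ne2 (red_ne_blue _ _) (red_ne_blue _ _) ui ui' uj).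
have ne2 : (j, true) != (j', true) by rewrite xpair_eqE andbT.
exact: (no_common_zero a_gen (red_ne_blue _ _) (red_ne_blue _ _) ne2 ui uj uj').
Qed.

Definition axis : {vspace 'rV[K]_3} := coef_kernel (fun k => (k == 1)%:R).

Lemma dim_axis : \dim axis == 2%N.
Proof. by apply: (@dim_coef_kernel _ 1); rewrite eqxx oner_neq0. Qed.

Lemma mem_axis (u : 'rV[K]_3) : (u \in axis) = (u 0 1 == 0).
Proof.
rewrite mem_coef_kernel (bigD1 1) // eqxx mul1r big1 /= ?addr0 // => k.
by move=> /negbTE ->; rewrite mul0r.
Qed.

(** On this point c_i y vanishes; c_i = 0 would make l_i and L_i equal. *)
Lemma meet_axis i : (meet i i <= axis)%VS.
Proof.
apply/subvP => u /mem_meet[ui]; rewrite mem_axis line_form_blue ui add0r => /eqP.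
rewrite mulf_eq0 => /orP[/eqP ai0|//].
have := dim_meet (red_ne_blue i i).
have -> : line_space (i, true) = line_space (i, false).
  by apply/vspaceP => w; rewrite !mem_line line_form_blue ai0 mul0r addr0.
by rewrite capvv (eqP (dim_line _)).
Qed.

(** Here y F = prod L - prod l is 0 - 0; moreover y cannot vanish there, as
    then l_i, L_i and L_j would be concurrent. *)
Lemma meet_residual i j u : i != j -> u \in meet i j -> u != 0 ->
  residual a (u 0) = 0.
Proof.
move=> ne_ij /mem_meet[ui uj] nz_u; apply/eqP.
have /eqP := residualE a (u 0).
rewrite [X in _ == X - _](bigD1 j) //= uj mul0r [X in _ == _ - X](bigD1 i) //=.
rewrite ui mul0r subrr mulf_eq0 => /orP[/eqP u1|//]; case/eqP: nz_u.
have ub : line_form a (i, true) (u 0) = 0 by rewrite line_form_blue ui u1 mulr0 addr0.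
have ne2 : (i, true) != (j, true) by rewrite xpair_eqE andbT.
exact: (no_common_zero a_gen (red_ne_blue _ _) (red_ne_blue _ _) ne2 ui ub uj).
Qed.
End Geometry.

Lemma meval_dhomogZ (K : comNzRingType) n d s (F : dhomog n K d) v :
  (s *: F : {mpoly K[n]}).@[v] = s * (F : {mpoly K[n]}).@[v].
Proof. exact: mevalZ. Qed.

Lemma meval_dhomog0 (K : comNzRingType) n d (F : dhomog n K d.+1) :
  (F : {mpoly K[n]}).@[fun=> 0] = 0.
Proof.
transitivity (F : {mpoly K[n]}).@[fun=> 0 * 0].
  by apply: meval_eq => k; rewrite mul0r.
by rewrite (meval_dhomog 0 (fun=> 0) (dhomog_is_dhomog F)) expr0n mul0r.
Qed.

Lemma constructible_of_configuration (R : realType) (X : curve R 4)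
    (F : dhomog 3 R[i] 4) (a : 'I_5 -> nat -> R[i]) :
    F \in sval X -> F != 0 -> position_det a != 0 ->
    (forall v, (F : {mpoly R[i][3]}).@[v] = residual a v) ->
  constructible X.
Proof.
move=> XF nz_F a_gen FE.
pose l b i : line R := exist (fun W : {vspace 'rV[R[i]]_3} => \dim W == 2%N) _
  (dim_line a_gen (i, b)).
pose P i j : Defs.point R := exist (fun W : {vspace 'rV[R[i]]_3} => \dim W == 1%N)
  (meet a i j) (dim_meet a_gen (red_ne_blue i j)).
exists (l false), (l true), P; split.
- by move=> i j; exact: erefl.
- by move=> i j i' j' eq_P; apply: (meet_inj a_gen (congr1 sval eq_P)).
- exists (exist (fun W : {vspace 'rV[R[i]]_3} => \dim W == 2%N) _
    (dim_axis _) : line R).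
  by move=> i; apply: meet_axis.
move=> i j ne_ij G u.
rewrite (projective_pointE XF nz_F) => /vlineP[s ->] Pu.
rewrite meval_dhomogZ; have [u0 | nz_u] := eqVneq u 0; last first.
  by rewrite FE (meet_residual a_gen ne_ij Pu nz_u) mulr0.
rewrite (meval_eq (v2 := fun=> 0)) ?meval_dhomog0 ?mulr0 // => k.
by rewrite u0 mxE.
Qed.

(** * Curves of residuals *)

Section ResidualCurve.
Variables (K : numFieldType) (q : 'I_5 -> nat -> {poly K}).
Local Notation X := (fun k : 'I_3 => 'X_k : {mpoly K[3]}).

Let qX i k := map_poly (@mpolyC 3 K) (q i k).
Let XC (k : 'I_3) : {poly {mpoly K[3]}} := ('X_k)%:P.

(** The residual of the curve q of configurations, as a polynomial in the time
    whose coefficients are quartics. *)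
Definition residual_curve : {poly {mpoly K[3]}} := residual qX XC.

Let coef_line p j : (line_form qX p XC)`_j =
  line_form (mconst_config (fun i k => (q i k)`_j)) p X.
Proof.
rewrite /line_form coef_sum; apply: eq_bigr => k _.
rewrite coefMC /line_coef coefD coefMn /qX !coef_map /=.
by rewrite /mconst_config.
Qed.

Lemma residual_curve_homog j : residual_curve`_j \is 4.-homog.
Proof.
pose hom e (P : {poly {mpoly K[3]}}) := forall j, P`_j \is e.-homog.
have hom_mul e1 e2 P1 P2 : hom e1 P1 -> hom e2 P2 -> hom (e1 + e2)%N (P1 * P2).
  move=> h1 h2 i; rewrite coefM; apply: rpred_sum => k _.
  by apply: dhomogM; [apply: h1 | apply: h2].
have hom_line p : hom 1%N (line_form qX p XC).
  move=> i; rewrite coef_line; apply: rpred_sum => k _.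
  rewrite /line_coef /mconst_config -mpolyCMn -mpolyCD mul_mpolyC rpredZ //.
  by rewrite dhomogX; apply/eqP/mdeg1.
have hom_prod (s : seq 'I_5) P (f : 'I_5 -> 'I_5 * bool) :
    hom (count P s) (\prod_(i <- s | P i) line_form qX (f i) XC).
  elim: s => [|i s IH].
    rewrite big_nil => i; rewrite coefC; case: ifP => _; first exact: dhomog1.
    exact: rpred0.
  by rewrite big_cons /=; case: (P i) => //; apply: hom_mul.
suff: hom 4%N residual_curve by apply.
move=> i; rewrite coef_sum; apply: rpred_sum => k _; rewrite coefM.
apply: rpred_sum => i' _.
rewrite /qX coef_map /= mul_mpolyC rpredZ //.
have := hom_prod (index_enum 'I_5) (fun j => j != k) (fun j => (j, (j < k)%N)).
have -> : count (fun j => j != k) (index_enum 'I_5) = 4%N; last by apply.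
by rewrite -sum1_count sum1_card cardC1 card_ord.
Qed.

Lemma horner_residual_curve t v :
  (map_poly (meval v) residual_curve).[t] =
  residual (fun i k => (q i k).[t]) v.
Proof.
pose phi := horner_eval t \o map_poly (meval v) : {rmorphism {poly {mpoly K[3]}} -> K}.
rewrite -[LHS]/(phi residual_curve) rmorph_residual.
congr residual.
  apply/boolp.funext => i; apply/boolp.funext => k.
  rewrite /phi /= /qX -map_poly_comp /horner_eval; congr (_.[t]).
  by rewrite (eq_map_poly (g := id)) ?map_poly_id // => c /=; rewrite mevalC.
apply/boolp.funext => k.
by rewrite /phi /= /XC map_polyC /= /horner_eval hornerC mevalXU.
Qed.

Lemma residual_curve0 : residual_curve`_0 =
  residual (mconst_config (fun i k => (q i k)`_0)) X.
Proof.
rewrite /residual_curve /residual coef_sum; apply: eq_bigr => i _.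
rewrite coefM big_ord_recl big_ord0 addr0 /= coef0_prod /qX coef_map /=.
by congr (_ * _); apply: eq_bigr => j _; apply: coef_line.
Qed.

Lemma residual_curve1 : 'X_1 * residual_curve`_1 =
  tangent (mconst_config (fun i k => (q i k)`_0))
          (mconst_config (fun i k => (q i k)`_1)) X.
Proof.
have -> : 'X_1 * residual_curve`_1 = (XC 1 * residual_curve)`_1 by rewrite coefCM.
rewrite /residual_curve (residualE qX XC) coefB !coef1_prod.
by congr (_ - _); apply: eq_bigr => i _; rewrite coef_line; congr (_ * _);
  apply: eq_bigr => j _; apply: coef_line.
Qed.
End ResidualCurve.

Section Conic.
Variable K : numFieldType.

(** The lines x + s y + s^2 z are tangent to a conic, so distinct values of s give
    lines in general position; those of parameters s and - s meet on y = 0.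
    Taking s = 1, ..., 5 for the red lines and - s for the blue ones gives
    Vandermonde determinants. *)
Definition conic_node (p : 'I_5 * bool) : int :=
  if p.2 then - (p.1.+1)%:Z else (p.1.+1)%:Z.

Definition conic_config (i : 'I_5) (k : nat) : K :=
  if k == 3 then - (i.+1)%:R *+ 2 else (i.+1)%:R ^+ k.

Lemma line_coef_conic p (k : 'I_3) :
  line_coef conic_config p k = (conic_node p)%:~R ^+ k.
Proof.
rewrite /line_coef /conic_config /conic_node; case: p => i [] /=.
  case: k => -[|[|[|//]]] ltk /=; rewrite ?mulr1n ?mulr0n ?addr0 ?expr0 //.
    by rewrite !expr1 mulrNz -pmulrn mulr2n addrA subrr add0r.
  by rewrite mulrNz -pmulrn sqrrN.
by rewrite mulr0n addr0; case: k => -[|[|[|//]]] ltk /=; rewrite -pmulrn.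
Qed.

Lemma conic_node_inj : injective conic_node.
Proof.
move=> [i b] [j c]; rewrite /conic_node /=.
by case: b; case: c => ij; [| lia | lia |]; congr (_, _); apply: val_inj => /=; lia.
Qed.

Lemma position_det_conic : position_det conic_config != 0.
Proof.
apply/prodf_neq0 => f /injectiveP inj_f.
have -> : \matrix_(j < 3, k < 3) line_coef conic_config (f j) k =
    (Vandermonde 3 (\row_j (conic_node (f j))%:~R))^T.
  by apply/matrixP => j k; rewrite !mxE line_coef_conic.
rewrite det_tr det_Vandermonde; apply/prodf_neq0 => i _; apply/prodf_neq0 => j lt_ij.
rewrite !mxE subr_eq0 eqr_int (inj_eq conic_node_inj).
by rewrite (inj_eq inj_f) neq_ltn lt_ij orbT.
Qed.
End Conic.

(** * Generic quartics are residuals *)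

Section FlatConfiguration.
Variable A : comNzRingType.
Implicit Types (a : 'I_5 -> nat -> A).

Lemma eq_line_coef a a' p k : (forall i l, (l < 4)%N -> a i l = a' i l) ->
  line_coef a p k = line_coef a' p k.
Proof. by move=> eq_a; rewrite /line_coef !eq_a // (ltn_trans (ltn_ord k)). Qed.

Lemma eq_position_det a a' : (forall i l, (l < 4)%N -> a i l = a' i l) ->
  position_det a = position_det a'.
Proof.
move=> eq_a; apply: eq_bigr => f _; congr (\det _).
by apply/matrixP => j k; rewrite !mxE (eq_line_coef _ _ eq_a).
Qed.

Lemma eq_residual a a' v : (forall i l, (l < 4)%N -> a i l = a' i l) ->
  residual a v = residual a' v.
Proof.
move=> eq_a; apply: eq_bigr => i _; rewrite eq_a //; congr (_ * _).
apply: eq_bigr => j _; apply: eq_bigr => k _.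
by rewrite (eq_line_coef _ _ eq_a).
Qed.

(** The twenty parameters of a configuration have to be listed as variables of a
    formula. *)
Definition config_of_seq (x : seq A) (i : 'I_5) (k : nat) : A := x`_(4 * i + k).

Lemma config_of_seq_onto a : exists x : 20.-tuple A,
  forall i k, (k < 4)%N -> config_of_seq x i k = a i k.
Proof.
exists [tuple a (inord (j %/ 4)) (j %% 4)%N | j < 20] => i k lt_k4.
have lt_20 : (4 * i + k < 20)%N by have := ltn_ord i; lia.
rewrite /config_of_seq -(tnth_nth _ _ (Ordinal lt_20)) tnth_mktuple /=.
rewrite mulnC divnMDl // divn_small // addn0 modnMDl modn_small //.
by congr (a _ _); apply: val_inj; rewrite /= inordK.
Qed.
End FlatConfiguration.

Section PolynomialForms.
Variable K : fieldType.
Variables (a : 'I_5 -> nat -> seq K -> K) (v : 'I_3 -> seq K -> K).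
Hypothesis pol_a : forall i k, polynomial_function (a i k).
Hypothesis pol_v : forall k, polynomial_function (v k).

Let pol_coef p k : polynomial_function (fun e => line_coef (fun i l => a i l e) p k).
Proof.
apply: polyfun_add => //.
by case: (_ && _); [apply: pol_a | apply: polyfun_const].
Qed.

Lemma polyfun_position_det :
  polynomial_function (fun e => position_det (fun i k => a i k e)).
Proof.
apply: polyfun_prod => f; apply: polyfun_sum => /= s.
apply: polyfun_mul; first exact: polyfun_const.
apply: polyfun_prod => j.
have [t tE] := pol_coef (f j) ((s : {perm _}) j).
by exists t => e; rewrite tE mxE.
Qed.

Lemma polyfun_residual :
  polynomial_function (fun e => residual (fun i k => a i k e) (fun k => v k e)).
Proof.
apply: polyfun_sum => i; apply: polyfun_mul => //; apply: polyfun_prod => j.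
by apply: polyfun_sum => k; apply: polyfun_mul.
Qed.
End PolynomialForms.

Section Dominance.
Variable K : numClosedFieldType.
Local Notation V := (dhomog 3 K 4).
Local Notation n := (\dim {:V}).

Definition quartic_of (y : 'I_n -> K) : V := \sum_i y i *: (vbasis {:V})`_i.

Lemma quartic_of_hcoord (F : V) : quartic_of (hcoord F) = F.
Proof. by rewrite [RHS](coord_vbasis (memvf F)). Qed.

Lemma meval_quartic_of y v : (quartic_of y : {mpoly K[3]}).@[v] =
  \sum_i y i * ((vbasis {:V})`_i : {mpoly K[3]}).@[v].
Proof.
rewrite /quartic_of !raddf_sum; apply: eq_bigr => i _.
exact: meval_dhomogZ.
Qed.

Definition is_residual (y : 'I_n -> K) := exists2 a, position_det a != 0 &
  forall v, (quartic_of y : {mpoly K[3]}).@[v] = residual a v.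

Lemma is_residual_generically_constant :
  exists2 h : {mpoly K[n]}, h != 0 & exists b : bool,
    forall y, h.@[y] != 0 -> is_residual y <-> b.
Proof.
pose a (i : 'I_5) (k : nat) (e : seq K) := e`_(n + (4 * i + k)).
pose v (k : 'I_3) (e : seq K) := e`_(n + 20 + k).
pose G e := position_det (fun i k => a i k e).
pose E (e : seq K) :=
  \sum_(i < n) e`_i * ((vbasis {:V})`_i : {mpoly K[3]}).@[fun k => v k e]
  + - residual (fun i k => a i k e) (fun k => v k e).
have pol_a i k : polynomial_function (a i k) by apply: polyfun_nth.
have pol_v k : polynomial_function (v k) by apply: polyfun_nth.
have pol_E : polynomial_function E.
  apply: polyfun_add; last by apply: polyfun_opp; apply: polyfun_residual.
  apply: polyfun_sum => i; apply: polyfun_mul; first exact: polyfun_nth.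
  exact: polyfun_meval.
have [h nz_h [b hb]] :=
  image_generically_constant n 20 3 (polyfun_position_det pol_a) pol_E.
exists h => //; exists b => y /hb <-.
have aE (x : 20.-tuple K) s (i : 'I_5) k : (k < 4)%N ->
    a i k ((point_env y ++ x) ++ s) = config_of_seq x i k.
  move=> lt_k4; rewrite /a -catA nth_cat size_point_env ltnNge leq_addr /= addKn.
  by rewrite nth_cat size_tuple ifT //; have := ltn_ord i; lia.
have EE (x : 20.-tuple K) (u : 3.-tuple K) : E ((point_env y ++ x) ++ u) =
    (quartic_of y : {mpoly K[3]}).@[tnth u] - residual (config_of_seq x) (tnth u).
  have vE k : v k ((point_env y ++ x) ++ u) = tnth u k.
    rewrite /v nth_cat size_cat size_point_env size_tuple ltnNge leq_addr /= addKn.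
    by rewrite (tnth_nth 0).
  rewrite /E meval_quartic_of; congr (_ - _).
    apply: eq_bigr => i _; rewrite (meval_eq _ vE); congr (_ * _).
    by rewrite -catA nth_cat size_point_env ltn_ord nth_point_env.
  have -> : (fun k => v k ((point_env y ++ x) ++ u)) = tnth u.
    by apply/boolp.funext => k.
  by apply: eq_residual => i k; apply: aE.
have GE (x : 20.-tuple K) : G (point_env y ++ x) = position_det (config_of_seq x).
  by apply: eq_position_det => i k; rewrite -{1}[_ ++ _]cats0; apply: aE.
split=> [[c nz_c cE]|[x nz_x xE]].
  have [x xc] := config_of_seq_onto c.
  exists x; first by rewrite -/(G _) GE (eq_position_det xc).
  by move=> u; rewrite EE (eq_residual _ xc) cE subrr.
exists (config_of_seq x); first by rewrite -GE.
move=> w; apply/eqP; rewrite -subr_eq0; apply/eqP.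
have wE : w = tnth [tuple w k | k < 3] by apply/boolp.funext => k; rewrite tnth_mktuple.
by rewrite wE -EE xE.
Qed.

Lemma quartic_of_poly (P : {poly {mpoly K[3]}}) t :
  (forall j, P`_j \is 4.-homog) ->
  let y k := \poly_(j < size P) hcoord (indhomog 4 P`_j : V) k in
  forall v, (quartic_of (fun k => (y k).[t]) : {mpoly K[3]}).@[v] =
            (map_poly (meval v) P).[t].
Proof.
move=> hom_P y v; rewrite (horner_coef_wide _ (size_poly _ _)) meval_quartic_of.
under eq_bigr => k _ do rewrite horner_poly mulr_suml.
rewrite exchange_big; apply: eq_bigr => j _ /=.
rewrite coef_map /= -[P`_j in RHS](insubdK (0 : V) (hom_P j)).
rewrite -[in RHS](quartic_of_hcoord (insubd _ _)) meval_quartic_of mulr_suml.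
by apply: eq_bigr => k _; rewrite mulrAC.
Qed.

(** The curve is p + t d + t^2 (c - p - d): it starts at the base point p in a
    direction d that produces w, and is at time 1 the conic configuration c. *)
Lemma curves_in_every_direction : exists y0 : 'I_n -> K, forall w : 'I_n -> K,
  exists (y : 'I_n -> {poly K}) (r : {poly K}),
    [/\ r != 0, forall k, (y k)`_0 = y0 k /\ (y k)`_1 = w k &
        forall t, r.[t] != 0 -> is_residual (fun k => (y k).[t])].
Proof.
pose p := int_config K base_config.
exists (hcoord (indhomog 4 (residual (mconst_config p) (fun k => 'X_k)) : V)) => w.
have hom_w : (quartic_of w : {mpoly K[3]}) \is 4.-homog by apply: dhomog_is_dhomog.
have [d dE] := tangent_onto hom_w.
pose c : 'I_5 -> nat -> K := @conic_config K.
pose q i k : {poly K} :=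
  (p i k)%:P + (d i k)%:P * 'X + (c i k - p i k - d i k)%:P * 'X^2.
have q0 : (fun i k => (q i k)`_0) = p.
  apply/boolp.funext => i; apply/boolp.funext => k.
  by rewrite /q !coefD !coefCM coefX coefXn coefC /= !mulr0 !addr0.
have q1 : (fun i k => (q i k)`_1) = d.
  apply/boolp.funext => i; apply/boolp.funext => k.
  by rewrite /q !coefD !coefCM coefX coefXn coefC /= mulr0 mulr1 addr0 add0r.
have q_at1 : (fun i k => (q i k).[1]) = c.
  apply/boolp.funext => i; apply/boolp.funext => k.
  by rewrite /q !hornerE /= !mulr1; ring.
pose P := residual_curve q.
exists (fun k => \poly_(j < size P) hcoord (indhomog 4 P`_j : V) k), (position_det q).
have position_at t : (position_det q).[t] = position_det (fun i k => (q i k).[t]).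
  by rewrite -[LHS]/(horner_eval t _) rmorph_position_det.
have coefE j k : (\poly_(j < size P) hcoord (indhomog 4 P`_j : V) k)`_j =
    hcoord (indhomog 4 P`_j : V) k.
  rewrite coef_poly; case: ltnP => // /(nth_default 0) ->.
  rewrite (_ : indhomog 4 0 = 0 :> V) ?/hcoord ?linear0 //.
  by apply: val_inj; rewrite /indhomog insubdK //; apply: rpred0.
split.
- apply: contraTneq (@position_det_conic K) => det0.
  by rewrite negbK -/c -q_at1 -position_at det0 horner0.
- move=> k; rewrite !coefE residual_curve0 q0; split=> //.
  have -> : P`_1 = quartic_of w.
    apply: (@mulfI _ 'X_1); first by rewrite -msupp_eq0 msuppX.
    by rewrite residual_curve1 q0 q1 dE.
  have -> : indhomog 4 (quartic_of w : {mpoly K[3]}) = quartic_of w.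
    by apply: val_inj; rewrite /indhomog insubdK.
  by rewrite /hcoord coord_sum_free // (basis_free (vbasisP _)).
move=> t nz_t; exists (fun i k => (q i k).[t]); first by rewrite -position_at.
move=> v; rewrite -horner_residual_curve quartic_of_poly // => j.
exact: residual_curve_homog.
Qed.

Lemma generic_is_residual :
  exists2 h : {mpoly K[n]}, h != 0 & forall y, h.@[y] != 0 -> is_residual y.
Proof.
have [h nz_h [b hb]] := is_residual_generically_constant.
have [y0 curves] := curves_in_every_direction.
by exists h => //; apply: generic_of_curves hb curves.
Qed.

Lemma dim_quartics_gt0 : (0 < n)%N.
Proof.
rewrite lt0n dimv_eq0; apply/eqP => V0.
have hom_X : ('X_0 ^+ 4 : {mpoly K[3]}) \is 4.-homog.
  have /(dhomogMn 4) : ('X_0 : {mpoly K[3]}) \is 1.-homog.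
    by rewrite dhomogX; apply/eqP/mdeg1.
  by rewrite mul1n.
have : DHomog hom_X \in {:V}%VS by rewrite memvf.
rewrite V0 memv0 => /eqP/(congr1 (@mpoly_of_dhomog 3 K 4))/eqP /=.
by rewrite expf_eq0 /= -msupp_eq0 msuppX.
Qed.
End Dominance.

Theorem theorem14 (R : realType) : construction_dense R 4.
Proof.
have [h nz_h h_residual] := generic_is_residual R[i].
have [U [openU U_neq0 UE]] := generic_in_projective nz_h (dim_quartics_gt0 R[i]).
exists U; split=> // X /UE [F XF [nz_F /h_residual [a a_gen aE]]].
apply: (constructible_of_configuration XF nz_F a_gen) => v.
by rewrite -aE quartic_of_hcoord.
Qed.
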